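(* Let $m\ge 0$, $q\ge 1$ be integers with $m+q\ge 2$. Consider the sequence of left $\mathbb{D}C_{m,q}$-modules $$\cdots\to\mathcal{F}_2\xrightarrow{\partial}\mathcal{F}_1\xrightarrow{\partial}\mathcal{F}_0\xrightarrow{\epsilon}\mathbb{Z}\to 0$$ in which, for each $r\ge 0$, $\mathcal{F}_{2r}$ is the free left $\mathbb{D}C_{m,q}$-module on one generator $\mathbf{v}_r$ placed over $r\cdot m$; $\mathcal{F}_{2r+1}$ is the free left $\mathbb{D}C_{m,q}$-module on one generator $\mathbf{w}_r$ placed over $(r\cdot m)\oplus 1$; $\epsilon:\mathcal{F}_0\to\mathbb{Z}$ is the morphism determined by $\epsilon_0(\mathbf{v}_0)=(0)\in\mathbb{Z}(0)$; $\partial:\mathcal{F}_{2r+2}\to\mathcal{F}_{2r+1}$ is the morphism determined by $\partial(\mathbf{v}_{r+1})=\mathrm T(\mathbf{w}_r)$; and $\partial:\mathcal{F}_{2r+1}\to\mathcal{F}_{2r}$ is the morphism determined by $\partial(\mathbf{w}_r)=\mathrm S(\mathbf{v}_r)$. Then $\mathcal{F}_\bullet\xrightarrow{\epsilon}\mathbb{Z}$ is a free resolution of the left $\mathbb{D}C_{m,q}$-module $\mathbb{Z}$ (i.e. the displayed sequence is exact).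
   Context: **Cyclic monoids.** $\mathbb{N}=\{0,1,\dots\}$. For $m\ge 0$, $q\ge 1$, the cyclic monoid $C_{m,q}$ of index $m$ and period $q$ is the set $\{0,1,\dots,m+q-1\}$ with addition $x\oplus y=\wp(x+y)$, where $\wp:\mathbb{N}\to C_{m,q}$ is given by $\wp(x)=x$ if $x<m+q$ and, for $x\ge m$, $\wp(x)$ is the unique element of $\{m,\dots,m+q-1\}$ congruent to $x$ modulo $q$. For $r\in\mathbb{N}$ and $x\in C_{m,q}$, $r\cdot x=x\oplus\cdots\oplus x$ ($r$ times) $=\wp(rx)$. It is assumed that $m+q\ge 2$. **The category $\mathbb{D}M$ and left modules.** For a monoid $M$ (written additively), $\mathbb{D}M$ is the category with object set $M$ and arrow set $M\times M\times M$, where $(x,y,z):y\to x+y+z$; composition is $(u,x+y+z,v)(x,y,z)=(u+x,y,z+v)$ and the identity of $x$ is $(0,x,0)$. A left $\mathbb{D}M$-module is a functor $\mathcal{A}:\mathbb{D}M\to\mathbf{Ab}$; morphisms are natural transformations, and exactness is checked pointwise at each $x\in M$. Write $x_*=\mathcal{A}(x,y,0):\mathcal{A}(y)\to\mathcal{A}(x+y)$ and $y^*=\mathcal{A}(0,x,y):\mathcal{A}(x)\to\mathcal{A}(x+y)$, so $\mathcal{A}(x,y,z)=x_*z^*=z^*x_*$. **The module $\mathbb{Z}$.** $\mathbb{Z}(x)$ is the free abelian group on one generator $(x)$, with $x_*(y)=(x+y)=y^*(x)$; it is isomorphic to the constant functor $\mathbb{Z}$. **Free modules on one generator.** For a symbol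 $s$ and an element $\pi s\in M$, the free left $\mathbb{D}M$-module on $s$ placed over $\pi s$ is the module $F$ with $F(x)$ the free abelian group on the triples $(u,s,v)$, $u,v\in M$, with $u+\pi s+v=x$, and $x_*(u,s,v)=(x+u,s,v)$, $y^*(u,s,v)=(u,s,v+y)$. One writes $s$ for $(0,s,0)\in F(\pi s)$. For any left module $\mathcal{A}$ and $a\in\mathcal{A}(\pi s)$, there is a unique morphism $f:F\to\mathcal{A}$ with $f_{\pi s}(s)=a$ (the morphism ''determined by'' $s\mapsto a$), namely $f_x(u,s,v)=u_*v^*a$. **The maps $\mathrm S$ and $\mathrm T$.** For a left $\mathbb{D}C_{m,q}$-module $\mathcal{A}$ and $x\in C_{m,q}$, $\mathrm S:\mathcal{A}(x)\to\mathcal{A}(x\oplus 1)$ is $\mathrm S(a)=1_*a-1^*a$. For $x\in C_{m,q}$ with $x\ge 1$, the trace map $\mathrm T:\mathcal{A}(x)\to\mathcal{A}(m\oplus(x-1))$ is $$\mathrm T(a)=\sum_{t=0}^{m+q-1}t^*(m+q-t-1)_*a-\sum_{s=0}^{m-1}s^*(m-s-1)_*a.$$ In particular $\mathrm T(\mathbf{w}_r)\in\mathcal{F}_{2r+1}((r+1)\cdot m)$ and $\mathrm S(\mathbf{v}_r)\in\mathcal{F}_{2r}((r\cdot m)\oplus 1)$. *)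

(* Defs.v *)
From HB Require Import structures.
From mathcomp Require Import all_boot all_order all_algebra zify.
From mathcomp Require Import freeg.

Set Implicit Arguments.
Unset Strict Implicit.
Unset Printing Implicit Defensive.

Import GRing.Theory.
Local Open Scope ring_scope.

Section FreeLift.
Variables (K : choiceType) (A : zmodType).

Definition flift (f : K -> A) (D : {freeg K}) : A :=
  fglift (f : K -> zmodule A) D.

Fact flift_is_zmod_morphism f : zmod_morphism (flift f).
Proof. exact: (@lift_is_additive int K (zmodule A)). Qed.

HB.instance Definition _ f :=
  GRing.isZmodMorphism.Build {freeg K} A (flift f) (flift_is_zmod_morphism f).

Lemma fliftU f k : flift f << k >> = f k.
Proof. by rewrite /flift liftU scale1r. Qed.

Lemma flift_uniq (g h : {additive {freeg K} -> A}) :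
  (forall k, g << k >> = h << k >>) -> g =1 h.
Proof.
move=> gh D; rewrite -[D]freeg_sumE !raddf_sum /=; apply: eq_bigr => k _.
by rewrite -[coeff k D]intz -freegU_mulz !raddfMz gh.
Qed.

End FreeLift.

(* Only commutative monoids occur below, hence [M : nmodType]. *)
Section LeftModules.
Variable M : nmodType.

(* The arrow (l, y, r) : y -> l + y + r. It is indexed by its codomain z, with
   a proof that l + y + r = z, so that composition and functoriality need no
   transport along the monoid laws. *)
Record arrow (y z : M) := Arrow {
  arl : M;
  arr : M;
  arrE : arl + y + arr = z
}.

Fact idarr_subproof (x : M) : 0 + x + 0 = x.
Proof. by rewrite add0r addr0. Qed.

Definition idarr (x : M) : arrow x x := Arrow (idarr_subproof x).

Fact comparr_subproof x y z (g : arrow y z) (f : arrow x y) :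
  arl g + arl f + x + (arr f + arr g) = z.
Proof. by case: g f => l r /= <- [l' r' /= <-]; rewrite !addrA. Qed.

Definition comparr x y z (g : arrow y z) (f : arrow x y) : arrow x z :=
  Arrow (comparr_subproof g f).

Record lmodule := LModule {
  lobj :> M -> zmodType;
  lact : forall y z, arrow y z -> {additive lobj y -> lobj z};
  lact_id : forall y (a : lobj y), lact (idarr y) a = a;
  lact_comp : forall x y z (g : arrow y z) (f : arrow x y) (a : lobj x),
    lact (comparr g f) a = lact g (lact f a)
}.

Record lhom (A B : lmodule) := LHom {
  happ :> forall x, {additive A x -> B x};
  hnat : forall y z (f : arrow y z) (a : A y),
    happ z (lact A f a) = lact B f (happ y a)
}.

(* x_* = A(x, y, 0) and y^* = A(0, x, y); the codomain is known up to an
   equality. *)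
Fact lstar_subproof (x y z : M) : x + y = z -> x + y + 0 = z.
Proof. by rewrite addr0. Qed.

Definition lstar (A : lmodule) (x y z : M) (e : x + y = z) : A y -> A z :=
  lact A (Arrow (lstar_subproof e)).

Fact rstar_subproof (x y z : M) : x + y = z -> 0 + x + y = z.
Proof. by rewrite add0r. Qed.

Definition rstar (A : lmodule) (y x z : M) (e : x + y = z) : A x -> A z :=
  lact A (Arrow (rstar_subproof e)).

Definition point (x : M) := {y : M | y == x}.

Fact point_act_subproof y z (f : arrow y z) (t : point y) :
  arl f + val t + arr f == z.
Proof. by rewrite (eqP (valP t)) arrE. Qed.

Definition point_act y z (f : arrow y z) (t : point y) : point z :=
  exist _ (arl f + val t + arr f) (point_act_subproof f t).

Definition Zmod_act y z (f : arrow y z) :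
    {additive {freeg (point y)} -> {freeg (point z)}} :=
  flift (fun t => << point_act f t >>).

Fact Zmod_act_id y (a : {freeg (point y)}) : Zmod_act (idarr y) a = a.
Proof.
apply: (@flift_uniq _ _ _ idfun) => t /=; rewrite fliftU.
by congr << _ >>; apply: val_inj; rewrite /= add0r addr0.
Qed.

Fact Zmod_act_comp x y z (g : arrow y z) (f : arrow x y)
    (a : {freeg (point x)}) :
  Zmod_act (comparr g f) a = Zmod_act g (Zmod_act f a).
Proof.
apply: (@flift_uniq _ _ _ (Zmod_act g \o Zmod_act f)) => t /=.
rewrite !fliftU; congr << _ >>; apply: val_inj; rewrite /= !addrA.
by [].
Qed.

Definition Zmod : lmodule :=
  @LModule (fun x => {freeg (point x)}) Zmod_act Zmod_act_id Zmod_act_comp.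

Definition Zgen (x : M) : Zmod x := << (exist _ x (eqxx x) : point x) >>.

Section FreeModule.
Variables (S : choiceType) (p : S -> M).

(* The triple ((u, s), v) stands for (u, s, v). *)
Definition triple (x : M) :=
  {t : M * S * M | t.1.1 + p t.1.2 + t.2 == x}.

Fact triple_act_subproof y z (f : arrow y z) (t : triple y) :
  (arl f + (val t).1.1) + p (val t).1.2 + ((val t).2 + arr f) == z.
Proof. by case: f t => l r /= <- [[[u s] v] /= /eqP <-]; rewrite !addrA. Qed.

Definition triple_act y z (f : arrow y z) (t : triple y) : triple z :=
  exist (fun t : M * S * M => t.1.1 + p t.1.2 + t.2 == z)
    (arl f + (val t).1.1, (val t).1.2, (val t).2 + arr f)
    (triple_act_subproof f t).

Definition free_act y z (f : arrow y z) :
    {additive {freeg (triple y)} -> {freeg (triple z)}} :=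
  flift (fun t => << triple_act f t >>).

Fact free_act_id y (a : {freeg (triple y)}) : free_act (idarr y) a = a.
Proof.
apply: (@flift_uniq _ _ _ idfun) => t /=; rewrite fliftU.
congr << _ >>; apply: val_inj; case: t => [[[u s] v] e] /=.
by rewrite add0r addr0.
Qed.

Fact free_act_comp x y z (g : arrow y z) (f : arrow x y)
    (a : {freeg (triple x)}) :
  free_act (comparr g f) a = free_act g (free_act f a).
Proof.
apply: (@flift_uniq _ _ _ (free_act g \o free_act f)) => t /=.
by rewrite !fliftU; congr << _ >>; apply: val_inj; rewrite /= !addrA.
Qed.

Definition free : lmodule :=
  @LModule (fun x => {freeg (triple x)}) free_act free_act_id free_act_comp.

Fact fgen_subproof (s : S) : 0 + p s + 0 == p s.
Proof. by rewrite add0r addr0. Qed.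

Definition fgen_triple (s : S) : triple (p s) :=
  exist (fun t : M * S * M => t.1.1 + p t.1.2 + t.2 == p s)
    (0, s, 0) (fgen_subproof s).

Definition fgen (s : S) : free (p s) := << fgen_triple s >>.

Variables (A : lmodule) (a : forall s, A (p s)).

(* The image u_* v^* a of (u, s, v) is A(u, p s, v) a. *)
Definition triple_arrow x (t : triple x) : arrow (p (val t).1.2) x :=
  Arrow (eqP (valP t)).

Definition determined_app x : {additive free x -> A x} :=
  flift (fun t => lact A (triple_arrow t) (a (val t).1.2)).

Fact determined_nat y z (f : arrow y z) (b : free y) :
  determined_app z (lact free f b) = lact A f (determined_app y b).
Proof.
apply: (@flift_uniq _ _ (determined_app z \o free_act f)
                        (lact A f \o determined_app y)) => t /=.
rewrite !fliftU -lact_comp; congr (lact A _ _).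
rewrite /triple_arrow /comparr /=; congr Arrow.
exact: eq_irrelevance.
Qed.

Definition determined : lhom free A := LHom determined_nat.

Lemma determined_fgen s : determined (p s) (fgen s) = a s.
Proof.
rewrite /= fliftU -[RHS]lact_id; congr (lact A _ _).
by rewrite /triple_arrow /idarr; congr Arrow; apply: eq_irrelevance.
Qed.

Lemma determined_uniq (f : lhom free A) :
  (forall s, f (p s) (fgen s) = a s) -> forall x, f x =1 determined x.
Proof.
move=> fE x; apply: flift_uniq => t.
have -> : << t >> = lact free (triple_arrow t) (fgen (val t).1.2).
  rewrite /= fliftU; congr << _ >>; apply: val_inj.
  by case: t => [[[u s] v] e] /=; rewrite addr0 add0r.
rewrite hnat fE -determined_fgen.
exact/esym/(hnat determined (triple_arrow t) (fgen (val t).1.2)).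
Qed.

End FreeModule.

Definition is_free (A : lmodule) : Prop :=
  exists (S : choiceType) (p : S -> M)
         (f : lhom (free p) A) (g : lhom A (free p)),
    forall x, cancel (f x) (g x) /\ cancel (g x) (f x).

Definition free1 (p : M) : lmodule := free (fun _ : unit => p).
Definition gen1 (p : M) : free1 p p := fgen (fun _ : unit => p) tt.
Definition determined1 (p : M) (A : lmodule) (a : A p) : lhom (free1 p) A :=
  @determined unit (fun _ => p) A (fun _ => a).

Definition exact_at (A B C : lmodule) (f : lhom A B) (g : lhom B C) : Prop :=
  forall x (b : B x), g x b = 0 <-> exists a : A x, f x a = b.

Definition epi (A B : lmodule) (f : lhom A B) : Prop :=
  forall x (b : B x), exists a : A x, f x a = b.

Definition free_resolution (A : lmodule) (F : nat -> lmodule)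
    (d : forall n, lhom (F n.+1) (F n)) (eps : lhom (F 0%N) A) : Prop :=
  [/\ forall n, is_free (F n),
      epi eps,
      exact_at (d 0%N) eps
    & forall n, exact_at (d n.+1) (d n)].

End LeftModules.

Definition cyclic (m q : nat) (q_gt0 : (0 < q)%N) : Type := 'I_(m + q).

Section Cyclic.
Variables (m q : nat) (q_gt0 : (0 < q)%N).
Local Notation C := (cyclic m q_gt0).

HB.instance Definition _ := Finite.on C.

Definition cval (x : C) : nat := nat_of_ord x.

(* The reduction map from nat to the cyclic monoid; see wp_small, wp_large. *)
Definition wp_nat (x : nat) : nat :=
  if (x < m + q)%N then x else (m + (x - m) %% q)%N.

Fact wp_subproof x : (wp_nat x < m + q)%N.
Proof.
by rewrite /wp_nat; case: (ltnP x) => // _; rewrite ltn_add2l ltn_pmod.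
Qed.

Definition wp (x : nat) : C := Ordinal (wp_subproof x).

Lemma wp_small x : (x < m + q)%N -> cval (wp x) = x.
Proof. by rewrite /cval /= /wp_nat => ->. Qed.

Lemma wp_large x : (m <= x)%N ->
  [/\ m <= cval (wp x), cval (wp x) < m + q & cval (wp x) = x %[mod q]]%N.
Proof.
move=> le_mx; split; last 2 [exact: ltn_ord].
  by rewrite /cval /= /wp_nat; case: ltnP => // _; apply: leq_addr.
rewrite /cval /= /wp_nat; case: ltnP => // _.
by rewrite modnDmr subnKC.
Qed.

Lemma cvalK x : wp (cval x) = x.
Proof. by apply: val_inj; rewrite /= /wp_nat ltn_ord. Qed.

Lemma eq_wp x y : (m <= x)%N -> (m <= y)%N -> x = y %[mod q] -> wp x = wp y.
Proof.
move=> le_mx le_my xy; apply: val_inj.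
have [lx ux ex] := wp_large le_mx; have [ly uy ey] := wp_large le_my.
rewrite -[LHS]/(cval _) -[RHS]/(cval _).
have: (cval (wp x) = cval (wp y) %[mod q])%N by rewrite ex ey.
rewrite -(subnKC lx) -(subnKC ly) => /eqP; rewrite eqn_modDl.
by rewrite !modn_small ?ltn_subLR // => /eqP ->.
Qed.

Definition cadd (x y : C) : C := wp (cval x + cval y).

Lemma wpD x y : wp (x + y) = cadd (wp x) (wp y).
Proof.
rewrite /cadd.
have wpDl u v : wp (u + v) = wp (cval (wp u) + v).
  have [/wp_small -> //|le_u] := ltnP u (m + q).
  have le_mu : (m <= u)%N by apply: leq_trans le_u; apply: leq_addr.
  have [l _ e] := wp_large le_mu.
  apply: eq_wp; first exact: leq_trans (leq_addr _ _).
    exact: leq_trans (leq_addr _ _).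
  by apply/eqP; rewrite eqn_modDr e.
by rewrite wpDl addnC wpDl addnC.
Qed.

Fact caddA : associative cadd.
Proof.
move=> x y z; rewrite -[x]cvalK -[y]cvalK -[z]cvalK -!wpD addnA.
by [].
Qed.

Fact caddC : commutative cadd.
Proof. by move=> x y; rewrite /cadd addnC. Qed.

Fact cadd0 : left_id (wp 0) cadd.
Proof. by move=> x; rewrite -[x]cvalK -wpD. Qed.

HB.instance Definition _ := GRing.isNmodule.Build C caddA caddC cadd0.

Lemma wp_is_additive x y : wp (x + y) = wp x + wp y.
Proof. exact: wpD. Qed.

Lemma wp_muln x r : wp x *+ r = wp (r * x).
Proof.
elim: r => [|r IH]; first by rewrite mulr0n mul0n.
by rewrite mulrS IH mulSn wp_is_additive.
Qed.

Definition Smap (A : lmodule C) (x : C) (a : A x) : A (x + wp 1) :=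
  lstar (addrC (wp 1) x) a - rstar (erefl (x + wp 1)) a.

Fact Tmap_subproof1 (x y : C) (t : 'I_(m + q)) :
  (0 < cval x)%N -> wp m + wp (cval x - 1) = y ->
  (wp (m + q - t - 1) + x) + wp t = y.
Proof.
move=> x_gt0 <-; rewrite -{1}[x]cvalK -!wp_is_additive.
have lt_t := ltn_ord t; set c := cval x in x_gt0 *.
have -> : (m + q - t - 1 + c + t = m + (c - 1) + q)%N by lia.
by apply: eq_wp; rewrite ?modnDr //; lia.
Qed.

Fact Tmap_subproof2 (x y : C) (s : 'I_m) :
  (0 < cval x)%N -> wp m + wp (cval x - 1) = y ->
  (wp (m - s - 1) + x) + wp s = y.
Proof.
move=> x_gt0 <-; rewrite -{1}[x]cvalK -!wp_is_additive.
by congr wp; have := ltn_ord s; lia.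
Qed.

(* The codomain y is m (+) (x - 1) up to the equality e; for x = wpos r it is
   vpos r.+1 by vpos_succ below. *)
Definition Tmap (A : lmodule C) (x y : C) (x_gt0 : (0 < cval x)%N)
    (e : wp m + wp (cval x - 1) = y) (a : A x) : A y :=
  \sum_(t < m + q) rstar (Tmap_subproof1 t x_gt0 e)
                     (lstar (erefl (wp (m + q - t - 1) + x)) a)
  - \sum_(s < m) rstar (Tmap_subproof2 s x_gt0 e)
                   (lstar (erefl (wp (m - s - 1) + x)) a).

Definition vpos (r : nat) : C := wp m *+ r.
Definition wpos (r : nat) : C := vpos r + wp 1.

Definition Fv (r : nat) : lmodule C := free1 (vpos r).
Definition Fw (r : nat) : lmodule C := free1 (wpos r).
Definition vgen (r : nat) : Fv r (vpos r) := gen1 (vpos r).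
Definition wgen (r : nat) : Fw r (wpos r) := gen1 (wpos r).

Definition augm : lhom (Fv 0) (Zmod C) :=
  @determined1 C (vpos 0) (Zmod C) (Zgen (0 : C)).

Definition dw (r : nat) : lhom (Fw r) (Fv r) :=
  determined1 (Smap (vgen r)).

Hypothesis mq_gt1 : (1 < m + q)%N.

Fact wpos_gt0 r : (0 < cval (wpos r))%N.
Proof.
rewrite /wpos /vpos wp_muln -wp_is_additive.
have [/wp_small -> //|le_x] := ltnP (r * m + 1) (m + q); first by lia.
have [|l _ _] := @wp_large (r * m + 1); first by lia.
by apply: leq_trans l; case: m le_x mq_gt1 => // ; lia.
Qed.

Fact vpos_succ r : wp m + wp (cval (wpos r) - 1) = vpos r.+1.
Proof.
have := wpos_gt0 r; rewrite /vpos mulrS !wp_muln /wpos /vpos wp_muln.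
rewrite -!wp_is_additive; have [lt_x|le_x] := ltnP (r * m + 1) (m + q).
  by rewrite wp_small // => _; congr wp; lia.
have [|l _ e] := @wp_large (r * m + 1); first by lia.
move: l e; set c := cval _ => l e c_gt0; apply: eq_wp; try lia.
apply/eqP; rewrite eqn_modDl -(eqn_modDr 1) subnK //.
exact/eqP.
Qed.

Definition dv (r : nat) : lhom (Fv r.+1) (Fw r) :=
  determined1 (Tmap (wpos_gt0 r) (vpos_succ r) (wgen r)).

(* [Fres r] is the sequence Fv r, Fw r, Fv r.+1, Fw r.+1, ...; thus
   [Fres 0 n.*2] is Fv n and [Fres 0 n.*2.+1] is Fw n. *)
Fixpoint Fres (r n : nat) : lmodule C :=
  match n with
  | 0%N => Fv r
  | 1%N => Fw r
  | n'.+2 => Fres r.+1 n'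
  end.

Fixpoint dres (r n : nat) : lhom (Fres r n.+1) (Fres r n) :=
  match n return lhom (Fres r n.+1) (Fres r n) with
  | 0%N => dw r
  | 1%N => dv r
  | n'.+2 => dres r.+1 n'
  end.

End Cyclic.

Lemma FresE m q (q_gt0 : (0 < q)%N) n :
  Fres m q_gt0 0 n.*2 = Fv m q_gt0 n /\ Fres m q_gt0 0 n.*2.+1 = Fw m q_gt0 n.
Proof.
have H r : Fres m q_gt0 r n.*2 = Fv m q_gt0 (n + r) /\
           Fres m q_gt0 r n.*2.+1 = Fw m q_gt0 (n + r).
  by elim: n r => [|n IH] r //; rewrite doubleS addSnnS; apply: IH.
by have := H 0%N; rewrite addn0.
Qed.

(* Main.v *)
From mathcomp Require Import all_boot all_algebra zify.
From mathcomp Require Import freeg.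
Require Import Defs.

(* Summed over all x in C, each F_n is the ring A (x) A with A = Z[X]/(X^N - X^m)
   the monoid ring and N = m + q; S is multiplication by X - Y, and T by
   (X^N - X^m - Y^N + Y^m) / (X - Y). The sequence is thus the usual 2-periodic
   resolution of a monogenic algebra. It is split, by left A-linear homotopies
   that respect the grading by C: Y^b |-> - (X^b - Y^b) / (X - Y) from F_2r to
   F_2r+1, and from F_2r+1 to F_2r+2 the coefficient of Y^(N-1). *)

Set Implicit Arguments.
Unset Strict Implicit.
Unset Printing Implicit Defensive.

Import GRing.Theory.
Local Open Scope ring_scope.

(** * Telescoping of divided differences *)

Section BivariateSums.
Variables (A : zmodType) (G : nat -> nat -> A).

(* The values of G on the monomials of X^a Y^b (X^n - Y^n) / (X - Y). *)
Definition hsum (n a b : nat) : A :=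
  \sum_(i < n) G (a + (n - i - 1)) (b + i).

Lemma hsumSr n a b : hsum n.+1 a b = hsum n a.+1 b + G a (b + n).
Proof.
rewrite /hsum big_ord_recr /= subSn // subnn addn0; congr (_ + _).
by apply: eq_bigr => i _; congr G; have := ltn_ord i; lia.
Qed.

(** Multiplication by X - Y: both sums come from the sum of length n + 1, one by dropping its last
    term ([hsumSr]), the other its first. *)
Lemma hsum_telescope n a b :
  hsum n a.+1 b - hsum n a b.+1 = G (a + n) b - G a (b + n).
Proof.
suff E : hsum n a.+1 b + G a (b + n) = hsum n a b.+1 + G (a + n) b.
  by apply/eqP; rewrite subr_eq addrAC eq_sym subr_eq E addrC.
rewrite -hsumSr /hsum big_ord_recl /= addrC; congr (_ + _).
  by apply: eq_bigr => i _; rewrite /bump /=; congr G; lia.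
by congr G; lia.
Qed.

End BivariateSums.

Lemma raddf_hsum (A B : zmodType) (f : {additive A -> B}) G n a b :
  f (hsum G n a b) = hsum (fun i j => f (G i j)) n a b.
Proof. exact: raddf_sum. Qed.

(** On the kernel of [g] the term [k (g b)] vanishes, so [h b] is a preimage of [b] under [f]. *)
Lemma exact_of_homotopy (A B C : zmodType) (f : {additive A -> B})
    (g : {additive B -> C}) (h : B -> A) (k : {additive C -> B}) :
  (forall a, g (f a) = 0) -> (forall b, f (h b) + k (g b) = b) ->
  forall b, g b = 0 <-> exists a, f a = b.
Proof.
move=> gf0 htpy b; split=> [gb0 | [a <-]]; last exact: gf0.
by exists (h b); rewrite -[RHS]htpy gb0 raddf0 addr0.
Qed.

(* A model of the resolution in which [ev a b], [ew a b] and [ev' a b] stand for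
   X^a Y^b modulo X^N = X^m and Y^N = Y^m, so that [dw] and [dv] multiply by
   X - Y and by (X^N - X^m - Y^N + Y^m) / (X - Y). *)
Section MonomialHomotopy.
Variables (m N : nat) (V W V' : zmodType).
Variables (ev : nat -> nat -> V) (ew : nat -> nat -> W) (ev' : nat -> nat -> V').
Variables (dw : {additive W -> V}) (dv : {additive V' -> W}).
Variables (hv : {additive V -> W}) (hw : {additive W -> V'}).

Hypothesis lt_mN : (m < N)%N.
Hypothesis ev_periodl : forall a b, ev (a + N) b = ev (a + m) b.
Hypothesis ev_periodr : forall a b, ev a (b + N) = ev a (b + m).
Hypothesis ew_periodl : forall a b, ew (a + N) b = ew (a + m) b.
Hypothesis ew_periodr : forall a b, ew a (b + N) = ew a (b + m).
Hypothesis dwE : forall a b, dw (ew a b) = ev a.+1 b - ev a b.+1.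
Hypothesis dvE : forall a b, dv (ev' a b) = hsum ew N a b - hsum ew m a b.
Hypothesis hvE : forall a b, (b < N)%N -> hv (ev a b) = - hsum ew b a 0.
Hypothesis hwE : forall a b, (b < N)%N ->
  hw (ew a b) = if b.+1 == N then ev' a 0 else 0.

(** The difference telescopes to (X^N - Y^N) - (X^m - Y^m), which the two period laws kill. *)
Lemma dv_shift a b : dv (ev' a.+1 b) = dv (ev' a b.+1).
Proof.
apply/eqP; rewrite -subr_eq0 !dvE opprD addrACA -opprD !hsum_telescope.
by rewrite ew_periodl ew_periodr subrr.
Qed.

Lemma dv_dw_monomial a b : dv (ev' a.+1 b - ev' a b.+1) = 0.
Proof. by rewrite raddfB dv_shift subrr. Qed.

Lemma dw_hsum n a b : dw (hsum ew n a b) = ev (a + n) b - ev a (b + n).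
Proof.
rewrite -hsum_telescope raddf_hsum /hsum -sumrB.
by apply: eq_bigr => i _; rewrite dwE.
Qed.

Lemma dw_dv_monomial a b : dw (dv (ev' a b)) = 0.
Proof. by rewrite dvE raddfB !dw_hsum ev_periodl ev_periodr subrr. Qed.

Lemma dw_hv_monomial a b : (b < N)%N -> dw (hv (ev a b)) = ev a b - ev (a + b) 0.
Proof. by move=> lt_b; rewrite hvE // raddfN dw_hsum opprB. Qed.

(** If b + 1 < N, then [hw] vanishes and the two sums from [hv] differ by the single term X^a Y^b.
    If b + 1 = N, then Y^N must first be reduced to Y^m before [hvE] applies; the resulting sum of
    length m cancels the negative part of [dv]. *)
Lemma homotopy_ew a b : (b < N)%N -> dv (hw (ew a b)) + hv (dw (ew a b)) = ew a b.
Proof.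
move=> lt_b; rewrite hwE // dwE raddfB hvE //.
case: eqP => [eb | nb]; last first.
  rewrite raddf0 add0r hvE; last by lia.
  by rewrite opprK hsumSr add0n addKr.
rewrite eb (ev_periodr a 0) !add0n hvE // dvE -[in hsum _ N]eb hsumSr.
by rewrite opprK add0n addrACA addNr addr0 addrAC subrr add0r.
Qed.

(** By [dv_shift] all powers of Y can be moved to X. For b = 0 only the last term of the sum of
    length N contains Y^(N-1), the one power that [hw] detects. *)
Lemma hw_dv_monomial a b : hw (dv (ev' a b)) = ev' (a + b) 0.
Proof.
elim: b a => [|b IH] a; last by rewrite -dv_shift IH addSnnS.
have hw0 n d : (n < N)%N -> hw (hsum ew n d 0) = 0.
  move=> lt_n; rewrite raddf_hsum; apply: big1 => i _.
  have lt_i := ltn_ord i; rewrite hwE; last by lia.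
  by rewrite ifN //; apply/eqP; lia.
have [n eN] : exists n, N = n.+1 by exists N.-1; lia.
rewrite dvE raddfB (hw0 m) ?subr0 // eN hsumSr raddfD hw0 ?add0r; last by lia.
by rewrite add0n hwE eN ?eqxx ?addn0.
Qed.

End MonomialHomotopy.

Section Resolution.
Variables (m q : nat) (q_gt0 : (0 < q)%N).
Hypothesis mq_gt1 : (1 < m + q)%N.
Local Notation C := (cyclic m q_gt0).
Local Notation wp := (wp m q_gt0).
Local Notation Fv := (Fv m q_gt0).
Local Notation Fw := (Fw m q_gt0).
Local Notation vpos := (vpos m q_gt0).
Local Notation wpos := (wpos m q_gt0).
Local Notation dw := (dw m q_gt0).
Local Notation dv := (dv q_gt0 mq_gt1).
Local Notation augm := (augm m q_gt0).

(** * Monomials in the free modules and the action on them *)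

Lemma wp_cval (x : C) : wp (cval x) = x. Proof. exact: cvalK. Qed.

Lemma lt_mmq : (m < m + q)%N.
Proof. by rewrite -[ltnLHS]addn0 ltn_add2l. Qed.

Lemma wpDmod a : wp (a + (m + q)) = wp (a + m).
Proof. by apply: eq_wp; rewrite ?addnA ?modnDr //; lia. Qed.

(* The value 0 off the fibre over x makes the boundary formulas hold for all
   exponents, without a side condition. *)
Definition btriple (p x : C) (a b : nat) : free1 p x :=
  if insub (wp a, tt, wp b) is Some t
  then << (t : triple (fun _ : unit => p) x) >> else 0.

Lemma btripleE (p x : C) (a b : nat) (t : triple (fun _ : unit => p) x) :
  val t = (wp a, tt, wp b) -> << t >> = btriple p x a b.
Proof.
move=> tE; rewrite /btriple; case: insubP => [u _ uE | /negP []].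
  by congr << _ >>; apply: val_inj; rewrite /= tE -uE.
by have := valP t; rewrite tE.
Qed.

Lemma btriple0 (p x : C) a b : wp a + p + wp b <> x -> btriple p x a b = 0.
Proof. by move=> /eqP ne; rewrite /btriple insubN. Qed.

Lemma btriple_congr (p x : C) a b a' b' :
  wp a = wp a' -> wp b = wp b' -> btriple p x a b = btriple p x a' b'.
Proof. by rewrite /btriple => -> ->. Qed.

Lemma flift_btriple (A : zmodType) (p x : C) (f : triple (fun _ => p) x -> A)
    g a b :
  (forall t, val t = (wp a, tt, wp b) -> f t = g) ->
  (wp a + p + wp b <> x -> g = 0) ->
  flift f (btriple p x a b) = g.
Proof.
move=> fg g0; case: (wp a + p + wp b =P x) => [e | ne].
  have /= <- := @btripleE p x a b (exist _ (wp a, tt, wp b) (introT eqP e)) erefl.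
  by rewrite fliftU fg.
by rewrite btriple0 // raddf0 g0.
Qed.

(** Canonical representatives serve as exponents of a basis triple; this supplies the bound on b
    under which the homotopies have a formula. *)
Lemma additive_btriple_ext (A : zmodType) (p x : C)
    (f g : {additive free1 p x -> A}) :
  (forall a b, (b < m + q)%N -> f (btriple p x a b) = g (btriple p x a b)) ->
  f =1 g.
Proof.
move=> fg; apply: (@flift_uniq _ _ f g) => t.
rewrite (@btripleE p x (cval (val t).1.1) (cval (val t).2)) ?fg ?ltn_ord //.
by rewrite !wp_cval; case: t => [[[u []] v] e].
Qed.

(** The fibre condition matters: C need not be cancellative, so a monomial outside the fibre over y,
    which is 0, could have a nonzero right-hand side over z. *)
Lemma lact_btriple (p y z : C) (f : arrow y z) a b c d :
  wp a + p + wp b = y -> arl f = wp c -> arr f = wp d ->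
  lact (free1 p) f (btriple p y a b) = btriple p z (c + a) (b + d).
Proof.
move=> e fl fr; apply: flift_btriple => [t tE | ne].
  by apply: btripleE; rewrite /= tE /= fl fr !wp_is_additive.
by case: (ne e).
Qed.

Lemma gen1_btriple (p : C) : gen1 p = btriple p p 0 0.
Proof. by apply: btripleE; congr (_, _, _); apply: val_inj. Qed.

Lemma wp0 : wp 0 = 0. Proof. by []. Qed.

Lemma wp0D0 (y : C) : wp 0 + y + wp 0 = y.
Proof. by rewrite wp0 add0r addr0. Qed.

Lemma lstar_btriple (p y z : C) a b c (e : wp c + y = z) :
  wp a + p + wp b = y ->
  lstar (A := free1 p) e (btriple p y a b) = btriple p z (c + a) b.
Proof. by move=> ey; rewrite /lstar (@lact_btriple _ _ _ _ _ _ c 0) ?addn0. Qed.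

Lemma rstar_btriple (p y z : C) a b c (e : y + wp c = z) :
  wp a + p + wp b = y ->
  rstar (A := free1 p) e (btriple p y a b) = btriple p z a (b + c).
Proof. by move=> ey; rewrite /rstar (@lact_btriple _ _ _ _ _ _ 0 c). Qed.

Lemma lact_gen1 (p x y : C) (f : arrow y x) a b c d
    (e : wp c + p + wp d = y) :
  arl f = wp a -> arr f = wp b ->
  lact (free1 p) f (rstar e (lstar erefl (gen1 p))) =
  btriple p x (a + c) (b + d).
Proof.
move=> fl fr; rewrite gen1_btriple lstar_btriple ?wp0D0 //.
rewrite rstar_btriple ?addn0 ?addr0 //.
by rewrite (@lact_btriple _ _ _ _ _ _ a b) // [(b + _)%N]addnC.
Qed.

(** * The boundary maps on monomials *)

Lemma vposE r : vpos r = wp (r * m).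
Proof. exact: wp_muln. Qed.

Lemma wposE r : wpos r = wp (r * m + 1).
Proof. by rewrite /wpos vposE -wp_is_additive. Qed.

Lemma dw_btriple r x a b :
  dw r x (btriple (wpos r) x a b) =
  btriple (vpos r) x a.+1 b - btriple (vpos r) x a b.+1.
Proof.
have posl : wp a.+1 + vpos r + wp b = wp a + wpos r + wp b.
  by rewrite vposE wposE -!wp_is_additive; congr wp; lia.
have posr : wp a + vpos r + wp b.+1 = wp a + wpos r + wp b.
  by rewrite vposE wposE -!wp_is_additive; congr wp; lia.
apply: flift_btriple => [t tE | ne]; last first.
  by rewrite !btriple0 ?subr0 ?posl ?posr.
rewrite /Smap /vgen gen1_btriple lstar_btriple ?rstar_btriple ?wp0 ?add0r ?addr0 //.
rewrite raddfB !(@lact_btriple _ _ _ _ _ _ a b) /= ?tE ?addn0 ?addn1 //.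
  by rewrite wp0 add0r.
by rewrite wp0 addr0 addrC.
Qed.

Lemma wp_period : wp (m + q) = wp m.
Proof. exact: (wpDmod 0). Qed.

Lemma dv_btriple r x a b :
  dv r x (btriple (vpos r.+1) x a b) =
  hsum (btriple (wpos r) x) (m + q) a b - hsum (btriple (wpos r) x) m a b.
Proof.
(* The exponents of each term add up to n - 1, and [wpos r] supplies the missing 1. Since m + q and
   m have the same image in C, both sums of T lie in one fibre. *)
have posT n c d i : wp n = wp m -> (i < n)%N ->
    wp (c + (n - i - 1)) + wpos r + wp (d + i) = wp c + vpos r.+1 + wp d.
  move=> en lt_in; rewrite vposE wposE -!wp_is_additive.
  have -> : (c + (n - i - 1) + (r * m + 1) + (d + i) = n + (c + r * m + d))%N.
    by lia.
  have -> : (c + r.+1 * m + d = m + (c + r * m + d))%N by lia.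
  by rewrite wp_is_additive en -wp_is_additive.
have sumT n : wp n = wp m -> wp a + vpos r.+1 + wp b <> x ->
    hsum (btriple (wpos r) x) n a b = 0.
  by move=> en ne; apply: big1 => i _; rewrite btriple0 // posT.
apply: flift_btriple => [t tE | ne]; last first.
  by rewrite !sumT ?subr0 // wp_period.
rewrite /Tmap raddfB.
by congr (_ - _); rewrite raddf_sum; apply: eq_bigr => i _; apply: lact_gen1;
  rewrite /= tE.
Qed.

Lemma btriple_periodl (p x : C) a b :
  btriple p x (a + (m + q)) b = btriple p x (a + m) b.
Proof. exact: btriple_congr (wpDmod a) erefl. Qed.

Lemma btriple_periodr (p x : C) a b :
  btriple p x a (b + (m + q)) = btriple p x a (b + m).
Proof. exact: btriple_congr erefl (wpDmod b). Qed.

Lemma dvw r x c : dv r x (dw r.+1 x c) = 0.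
Proof.
pose f : {additive Fw r.+1 x -> Fw r x} := dv r x \o dw r.+1 x.
apply: (@additive_btriple_ext _ _ _ f \0) => a b _.
have dv0 := dv_dw_monomial (@btriple_periodl _ x) (@btriple_periodr _ x)
  (dv_btriple r x) a b.
exact: etrans (congr1 (dv r x) (dw_btriple r.+1 x a b)) dv0.
Qed.

Lemma dwv r x c : dw r x (dv r x c) = 0.
Proof.
pose f : {additive Fv r.+1 x -> Fv r x} := dw r x \o dv r x.
apply: (@additive_btriple_ext _ _ _ f \0) => a b _.
exact: (dw_dv_monomial (@btriple_periodl _ x) (@btriple_periodr _ x)
  (dw_btriple r x) (dv_btriple r x)).
Qed.

(** * The homotopies and exactness in positive degrees *)

Definition hv r x : {additive Fv r x -> Fw r x} :=
  flift (fun t : triple (fun _ : unit => vpos r) x =>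
    - hsum (btriple (wpos r) x) (cval (val t).2) (cval (val t).1.1) 0).

Definition hw r x : {additive Fw r x -> Fv r.+1 x} :=
  flift (fun t : triple (fun _ : unit => wpos r) x =>
    if (cval (val t).2).+1 == (m + q)%N
    then btriple (vpos r.+1) x (cval (val t).1.1) 0 else 0).

(** The bound on b is essential: the length of the sum is not determined by the class of b in C. *)
Lemma hv_btriple r x a b : (b < m + q)%N ->
  hv r x (btriple (vpos r) x a b) = - hsum (btriple (wpos r) x) b a 0.
Proof.
move=> lt_b; apply: flift_btriple => [t tE | ne].
  rewrite tE wp_small //; congr (- _); apply: eq_bigr => i _.
  by apply: btriple_congr => //; rewrite !wp_is_additive wp_cval.
rewrite (_ : hsum _ _ _ _ = 0) ?oppr0 //; apply: big1 => i _.
apply: btriple0 => e; apply: ne; rewrite -e vposE wposE -!wp_is_additive.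
by congr wp; have := ltn_ord i; lia.
Qed.

Lemma hw_btriple r x a b : (b < m + q)%N ->
  hw r x (btriple (wpos r) x a b) =
  if b.+1 == (m + q)%N then btriple (vpos r.+1) x a 0 else 0.
Proof.
move=> lt_b; apply: flift_btriple => [t tE | ne].
  rewrite tE wp_small //; case: ifP => // _.
  by apply: btriple_congr => //; rewrite wp_cval.
case: eqP => // eb; apply: btriple0 => e; apply: ne.
rewrite -e vposE wposE -!wp_is_additive.
(* For b = m + q - 1, the 1 in [wpos r] completes a full m + q, which C identifies with m, the step
   from [vpos r] to [vpos r.+1]. *)
have -> : (a + (r * m + 1) + b = a + r * m + (m + q))%N by lia.
by rewrite wpDmod; congr wp; lia.
Qed.

Lemma homotopy_Fw r x c : dv r x (hw r x c) + hv r x (dw r x c) = c.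
Proof.
pose f : {additive Fw r x -> Fw r x} :=
  (dv r x \o hw r x) \+ (hv r x \o dw r x).
apply: (@additive_btriple_ext _ _ _ f idfun) => a b lt_b.
exact: (homotopy_ew lt_mmq (@btriple_periodr _ x) (dw_btriple r x) (dv_btriple r x)
  (@hv_btriple r x) (@hw_btriple r x)).
Qed.

Lemma dw_hv r x a b : (b < m + q)%N ->
  dw r x (hv r x (btriple (vpos r) x a b)) =
  btriple (vpos r) x a b - btriple (vpos r) x (a + b) 0.
Proof. exact: (dw_hv_monomial (dw_btriple r x) (@hv_btriple r x)). Qed.

(** On X^a Y^b the first term gives X^a Y^b - X^(a+b) and the second restores X^(a+b). *)
Lemma homotopy_Fv r x c : dw r.+1 x (hv r.+1 x c) + hw r x (dv r x c) = c.
Proof.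
pose f : {additive Fv r.+1 x -> Fv r.+1 x} :=
  (dw r.+1 x \o hv r.+1 x) \+ (hw r x \o dv r x).
apply: (@additive_btriple_ext _ _ _ f idfun) => a b lt_b.
have hwdv := hw_dv_monomial lt_mmq (@btriple_periodl _ x) (@btriple_periodr _ x)
  (dv_btriple r x) (@hw_btriple r x) a b.
exact: etrans (congr2 +%R (dw_hv r.+1 x a lt_b) hwdv) (subrK _ _).
Qed.

Lemma exact_Fw r : exact_at (dv r) (dw r).
Proof. by move=> x; exact: exact_of_homotopy (@dwv r x) (@homotopy_Fw r x). Qed.

Lemma exact_Fv r : exact_at (dw r.+1) (dv r).
Proof. by move=> x; exact: exact_of_homotopy (@dvw r x) (@homotopy_Fv r x). Qed.

(** * The augmentation and exactness in degree zero *)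

Definition haug x : {additive Zmod C x -> Fv 0 x} :=
  flift (fun t : point x => btriple (vpos 0) x (cval (val t)) 0).

Lemma augm_btriple x a b (t : point x) : val t = wp (a + b) ->
  augm x (btriple (vpos 0) x a b) = << t >>.
Proof.
move=> tE; apply: flift_btriple => [u uE | []]; last first.
  (* The monomial cannot lie off the fibre, because [t] is a point over x and [vpos 0] computes to
     0. *)
  by rewrite addr0 -wp_is_additive -tE; apply/eqP/(valP t).
rewrite /Zgen /= fliftU; congr << _ >>; apply: val_inj.
by rewrite /= uE /= addr0 -wp_is_additive tE.
Qed.

Lemma haug_augm x a b :
  haug x (augm x (btriple (vpos 0) x a b)) = btriple (vpos 0) x (a + b) 0.
Proof.
case: (wp (a + b) =P x) => [e | ne].
  rewrite (@augm_btriple x a b (exist _ (wp (a + b)) (introT eqP e))) //.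
  by rewrite /haug /= fliftU; apply: btriple_congr => //; apply: wp_cval.
have ne' c d : (c + d = a + b)%N -> wp c + vpos 0 + wp d <> x.
  by move=> ecd; rewrite addr0 -wp_is_additive ecd.
by rewrite !btriple0 ?raddf0 //; apply: ne'; rewrite ?addn0.
Qed.

Lemma augmK x c : augm x (haug x c) = c.
Proof.
apply: (@flift_uniq _ _ (augm x \o haug x) idfun) => t /=.
by rewrite /haug /= fliftU; apply: augm_btriple; rewrite addn0 wp_cval.
Qed.

Lemma augm_dw x c : augm x (dw 0 x c) = 0.
Proof.
pose f : {additive Fw 0 x -> Zmod C x} := augm x \o dw 0 x.
apply: (@additive_btriple_ext _ _ _ f \0) => a b _.
(* [haug] is injective, so the identity may be tested after it; [haug_augm] holds on and off the
   fibre and thus avoids a case split. *)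
apply: (can_inj (@augmK x)).
by rewrite /f /= dw_btriple !raddfB !haug_augm addSnnS subrr raddf0.
Qed.

(** As in [homotopy_Fv], with [haug] after [augm] now supplying X^(a+b). *)
Lemma homotopy_Fv0 x c : dw 0 x (hv 0 x c) + haug x (augm x c) = c.
Proof.
pose f : {additive Fv 0 x -> Fv 0 x} :=
  (dw 0 x \o hv 0 x) \+ (haug x \o augm x).
apply: (@additive_btriple_ext _ _ _ f idfun) => a b lt_b.
by rewrite /f /= dw_hv // haug_augm subrK.
Qed.

Lemma exact_augm : exact_at (dw 0) augm.
Proof.
by move=> x; exact: exact_of_homotopy (@augm_dw x) (@homotopy_Fv0 x).
Qed.

(** * Assembly of the resolution *)

Lemma exact_dres n r :
  exact_at (dres q_gt0 mq_gt1 r n.+1) (dres q_gt0 mq_gt1 r n).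
Proof.
(* [dres] recurses by two degrees while raising r, so the induction runs on a bound for n with r
   general. *)
have [k] := ubnP n; elim: k n r => // k IH [|[|n]] r lt_nk.
- exact: exact_Fw.
- exact: exact_Fv.
- by apply: (IH n r.+1); lia.
Qed.

Lemma free_is_free (M : nmodType) (S : choiceType) (p : S -> M) :
  is_free (free p).
Proof.
exists S, p; pose id_free := @LHom M (free p) (free p)
  (fun x => (idfun : {additive free p x -> free p x})) (fun _ _ _ _ => erefl).
by exists id_free, id_free.
Qed.

Lemma Fres_is_free n r : is_free (Fres m q_gt0 r n).
Proof.
have [k] := ubnP n; elim: k n r => // k IH [|[|n]] r lt_nk.
- exact: free_is_free.
- exact: free_is_free.
- by apply: (IH n r.+1); lia.
Qed.

End Resolution.

Theorem theorem4p2 (m q : nat) (q_gt0 : (0 < q)%N) (mq_gt1 : (1 < m + q)%N) :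
  free_resolution (dres q_gt0 mq_gt1 0) (augm m q_gt0).
Proof.
split.
- by move=> n; apply: Fres_is_free.
- by move=> x c; exists (haug x c); apply: augmK.
- exact: exact_augm.
- by move=> n; apply: exact_dres.
Qed.
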